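(* Let $(A,\prec,\succ)$ be a dendriform algebra over a field $k$ of characteristic zero, augmented by a unit $\mathbf 1$ to $\overline A=A\oplus k\mathbf 1$. Let $a\in A$, let $U'_0:=\lambda a$, and let $U'_n:=U'_n(a)$, $n\in\mathbb N$, be elements in $\lambda\overline A[[\lambda]]$ such that $$X=\overrightarrow{\prod_{n\ge0}}^{*}\exp^*(U'_n)=\exp^*(U'_0)*\exp^*(U'_1)*\exp^*(U'_2)*\cdots*\exp^*(U'_n)*\cdots,$$ $$Y=\overleftarrow{\prod_{n\ge0}}^{*}\exp^*(-U'_n)=\cdots*\exp^*(-U'_n)*\cdots*\exp^*(-U'_2)*\exp^*(-U'_1)*\exp^*(-U'_0),$$ where $X$ and $Y$ are the solutions in $\overline A[[\lambda]]$ of the equations $$X=\mathbf 1+\lambda a\prec X,\qquad Y=\mathbf 1-Y\succ\lambda a .$$ Then these elements $U'_n$ obey the following recursive equation: $$U'_{n+1}:=\sum_{l>0}\frac{(-1)^l\, l}{(l+1)!}\,L_\rhd[U'_n]^{(l)}(U'_n),\qquad n\ge 0 .$$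
   Context: A dendriform algebra over $k$ is a $k$-vector space $A$ with two bilinear operations $\prec,\succ$ such that, with $a*b:=a\prec b+a\succ b$, for all $a,b,c\in A$: $(a\prec b)\prec c=a\prec(b*c)$, $(a\succ b)\prec c=a\succ(b\prec c)$, $a\succ(b\succ c)=(a*b)\succ c$. The product $*$ is then associative. Augmentation: $\overline A:=A\oplus k\mathbf 1$, with $a\prec\mathbf 1:=a=:\mathbf 1\succ a$ and $\mathbf 1\prec a:=0=:a\succ\mathbf 1$ for $a\in A$, and $\mathbf 1*\mathbf 1=\mathbf 1$, so $\mathbf 1$ is a unit for $*$ ($\mathbf 1\prec\mathbf 1$ and $\mathbf 1\succ\mathbf 1$ are not defined). The operations are extended to formal power series in the parameter $\lambda$. The (formal) solutions of the two equations are $X=\sum_{n\ge0}\lambda^n w_\prec^{(n)}(a)$ and $Y=\sum_{n\ge0}(-\lambda)^n w_\succ^{(n)}(a)$, where $w_\prec^{(0)}(a)=w_\succ^{(0)}(a)=\mathbf 1$, $w_\prec^{(n)}(a)=a\prec w_\prec^{(n-1)}(a)$, $w_\succ^{(n)}(a)=w_\succ^{(n-1)}(a)\succ a$. Left pre-Lie product: $a\rhd b:=a\succ b-b\prec a$. Operator: $L_\rhd[a](b):=a\rhd b$, and $L_\rhd[a]^{(l)}$ is its $l$-fold iterate. Exponential with respect to $*$: $\exp^*(x):=\sum_{n\ge0}x^{*n}/n!$, with $x^{*0}=\mathbf 1$. The arrows on the infinite $*$-products indicate the order of the factors: index increasing from left to right for $\overrightarrow{\prod}$, and from right to left for $\o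verleftarrow{\prod}$.
   Formalization: The product formulas alone do not determine the U'_n, so the condition that each remainder R_n, with X = exp*(U'_0)*...*exp*(U'_{n-1})*R_n, solves R_n = 1 + U'_n ≺ R_n is added; the product formulas plus this condition are proved equivalent to the recursion. *)

(* Defs.v *)
From HB Require Import structures.
From mathcomp Require Import all_boot all_order all_algebra.
From mathcomp Require Import sesquilinear.
From mathcomp Require Import boolp functions.

Set Implicit Arguments.
Unset Strict Implicit.
Unset Printing Implicit Defensive.

Import GRing.Theory.
Local Open Scope ring_scope.

Declare Scope dendriform_scope.
Delimit Scope dendriform_scope with dend.
Local Open Scope dendriform_scope.

Reserved Notation "x ≺ y" (at level 45, no associativity).
Reserved Notation "x ≻ y" (at level 45, no associativity).

HB.mixin Record Lmodule_isDendriform (k : fieldType) A of GRing.Lmodule k A := {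
  dprec : {bilinear A -> A -> A};
  dsucc : {bilinear A -> A -> A};
  dprecA : forall a b c : A,
    dprec (dprec a b) c = dprec a (dprec b c + dsucc b c);
  dsuccprecA : forall a b c : A,
    dprec (dsucc a b) c = dsucc a (dprec b c);
  dsuccA : forall a b c : A,
    dsucc a (dsucc b c) = dsucc (dprec a b + dsucc a b) c
}.

#[short(type="dendriformType")]
HB.structure Definition Dendriform (k : fieldType) :=
  {A of Lmodule_isDendriform k A & GRing.Lmodule k A}.

Definition dstar (k : fieldType) (A : dendriformType k) (a b : A) : A :=
  dprec a b + dsucc a b.

Section DendriformTheory.
Variables (k : fieldType) (A : dendriformType k).
Implicit Types a b c : A.

Lemma dstarDl a b c : dstar (a + b) c = dstar a c + dstar b c.
Proof. by rewrite /dstar !linearDl addrACA. Qed.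

Lemma dstarDr a b c : dstar a (b + c) = dstar a b + dstar a c.
Proof. by rewrite /dstar !linearDr addrACA. Qed.

Lemma dstarZl (x : k) a b : dstar (x *: a) b = x *: dstar a b.
Proof. by rewrite /dstar !linearZl_LR scalerDr. Qed.

Lemma dstarZr (x : k) a b : dstar a (x *: b) = x *: dstar a b.
Proof. by rewrite /dstar !linearZr_LR scalerDr. Qed.

Lemma dstarA a b c : dstar a (dstar b c) = dstar (dstar a b) c.
Proof.
by rewrite /dstar linearDl dprecA dsuccprecA [dsucc a (_ + _)]linearDr dsuccA addrA.
Qed.

End DendriformTheory.

(* The pair (a, x) stands for a + x 1. *)
Definition augm (k : fieldType) (A : dendriformType k) : Type := (A * k^o)%type.

Section Augmentation.
Variables (k : fieldType) (A : dendriformType k).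
Local Notation Abar := (augm A).

HB.instance Definition _ := GRing.Lmodule.copy Abar (A * k^o)%type.

Definition aug_in (a : A) : Abar := (a, 0).
Definition aug_one : Abar := (0, 1).
Definition aug_mul (u v : Abar) : Abar :=
  (dstar u.1 v.1 + (u.2 : k) *: v.1 + (v.2 : k) *: u.1, u.2 * v.2).

Fact aug_mulA : associative aug_mul.
Proof.
move=> [a x] [b y] [c z]; congr pair; rewrite /= ?mulrA //.
rewrite (dstarDr a (_ + _)) (dstarDr a (dstar b c)) !dstarZr.
rewrite (dstarDl (_ + _) ((y : k) *: a)) (dstarDl (dstar a b)) !dstarZl dstarA.
move: (dstar a c) (dstar a b) (dstar b c) (dstar (dstar a b) c) => q r s p.
rewrite !scalerDr !scalerA [z * x]mulrC [z * y]mulrC -!addrA; congr (_ + _).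
rewrite [RHS]addrCA; congr (_ + _); rewrite [LHS]addrCA; congr (_ + _).
by rewrite [LHS]addrCA.
Qed.
Fact aug_mul1 : left_id aug_one aug_mul.
Proof.
move=> [a x]; congr pair; rewrite /= ?mul1r //.
by rewrite /dstar !linear0l !add0r scale1r scaler0 addr0.
Qed.
Fact aug_mulr1 : right_id aug_one aug_mul.
Proof.
move=> [a x]; congr pair; rewrite /= ?mulr1 //.
by rewrite /dstar !linear0r !add0r scale1r scaler0 add0r.
Qed.
Fact aug_mulDl : left_distributive aug_mul +%R.
Proof.
move=> [a x] [b y] [c z]; congr pair; rewrite /= ?mulrDl //.
rewrite dstarDl scalerDl scalerDr; move: (dstar a c) (dstar b c) => p q.
by rewrite [RHS]addrACA [X in _ = X + _]addrACA.
Qed.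
Fact aug_mulDr : right_distributive aug_mul +%R.
Proof.
move=> [a x] [b y] [c z]; congr pair; rewrite /= ?mulrDr //.
rewrite dstarDr scalerDl scalerDr; move: (dstar a b) (dstar a c) => p q.
by rewrite [RHS]addrACA [X in _ = X + _]addrACA.
Qed.
Fact aug_one_neq0 : aug_one != 0.
Proof. by apply/eqP => -[] /eqP; rewrite oner_eq0. Qed.

HB.instance Definition _ := GRing.Zmodule_isNzRing.Build Abar
  aug_mulA aug_mul1 aug_mulr1 aug_mulDl aug_mulDr aug_one_neq0.

Fact aug_scaleAl (x : k) (u v : Abar) : x *: (u * v) = (x *: u) * v.
Proof.
case: u v => [a y] [b z]; apply: injective_projections; last exact: (mulrA x y z).
change (x *: (dstar a b + (y : k) *: b + (z : k) *: a) =
  dstar (x *: a) b + (x * y) *: b + (z : k) *: (x *: a)).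
by rewrite dstarZl; move: (dstar a b) => p; rewrite !scalerDr !scalerA [x * z]mulrC.
Qed.
HB.instance Definition _ := GRing.Lmodule_isLalgebra.Build k Abar aug_scaleAl.

Fact aug_scaleAr (x : k) (u v : Abar) : x *: (u * v) = u * (x *: v).
Proof.
case: u v => [a y] [b z]; apply: injective_projections; last exact: (mulrCA x y z).
change (x *: (dstar a b + (y : k) *: b + (z : k) *: a) =
  dstar a (x *: b) + (y : k) *: (x *: b) + (x * z) *: a).
by rewrite dstarZr; move: (dstar a b) => p; rewrite !scalerDr !scalerA [x * y]mulrC.
Qed.
HB.instance Definition _ := GRing.Lalgebra_isAlgebra.Build k Abar aug_scaleAr.

(* 1 ≺ 1 and 1 ≻ 1 have no mathematical meaning; here they get the value 0. *)
Definition aug_prec (u v : Abar) : Abar := (dprec u.1 v.1 + (v.2 : k) *: u.1, 0).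
Definition aug_succ (u v : Abar) : Abar := (dsucc u.1 v.1 + (u.2 : k) *: v.1, 0).

Lemma aug_precE (a b : A) : aug_prec (aug_in a) (aug_in b) = aug_in (dprec a b).
Proof. by rewrite /aug_prec /= scale0r addr0. Qed.
Lemma aug_succE (a b : A) : aug_succ (aug_in a) (aug_in b) = aug_in (dsucc a b).
Proof. by rewrite /aug_succ /= scale0r addr0. Qed.
Lemma aug_prec1 (a : A) : aug_prec (aug_in a) 1 = aug_in a.
Proof. by rewrite /aug_prec /= linear0r add0r scale1r. Qed.
Lemma aug_1succ (a : A) : aug_succ 1 (aug_in a) = aug_in a.
Proof. by rewrite /aug_succ /= linear0l add0r scale1r. Qed.
Lemma aug_1prec (a : A) : aug_prec 1 (aug_in a) = 0.
Proof. by rewrite /aug_prec /= linear0l add0r scaler0. Qed.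
Lemma aug_succ1 (a : A) : aug_succ (aug_in a) 1 = 0.
Proof. by rewrite /aug_succ /= linear0r add0r scaler0. Qed.

End Augmentation.

(* Formal power series in λ: x n is the coefficient of λ^n in x. *)
Definition series (V : Type) : Type := nat -> V.

HB.instance Definition _ (V : zmodType) :=
  GRing.Zmodule.copy (series V) (nat -> V).
HB.instance Definition _ (R : pzRingType) (V : lmodType R) :=
  GRing.Lmodule.copy (series V) (nat -> V).

Definition cauchy (V : zmodType) (op : V -> V -> V) (x y : series V) : series V :=
  fun n => \sum_(i < n.+1) op (x i) (y (n - i)%N).

Lemma series_coefD (V : zmodType) (x y : series V) n : (x + y) n = x n + y n.
Proof. by []. Qed.

Lemma series_coef0 (V : zmodType) n : (0 : series V) n = 0.
Proof. by []. Qed.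

Lemma series_coefZ (R : pzRingType) (V : lmodType R) (c : R) (x : series V) n :
  (c *: x) n = c *: x n.
Proof. by []. Qed.

Lemma series_coef_sum (V : zmodType) I (r : seq I) (P : pred I)
    (F : I -> series V) n :
  (\sum_(i <- r | P i) F i) n = \sum_(i <- r | P i) F i n.
Proof. by elim/big_rec2: _ => // i y x _ <-. Qed.

Section SeriesRing.
Variable R : nzRingType.
Implicit Types x y z : series R.

Definition series_one : series R := fun n => (n == 0%N)%:R.
Definition series_mul x y : series R := cauchy *%R x y.

Lemma series_mulE_rev x y n :
  series_mul x y n = \sum_(i < n.+1) x (n - i)%N * y i.
Proof.
rewrite /series_mul /cauchy (reindex_inj rev_ord_inj) /=.
by apply: eq_bigr => i _; rewrite (sub_ordK i).
Qed.

Fact series_mulA : associative series_mul.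
Proof.
move=> x y z; apply/funext => n.
rewrite [RHS]series_mulE_rev /series_mul {1}/cauchy.
pose f i j := x i * (y (n - j - i)%N * z j).
transitivity (\sum_(i < n.+1) \sum_(j < n.+1 | (j <= n - i)%N) f i j).
  apply: eq_bigr => i _; rewrite -/(series_mul y z) series_mulE_rev mulr_sumr.
  rewrite (big_ord_narrow_leq (leq_subr i n)) /f.
  by apply: eq_bigr => j _; rewrite /= subnAC.
rewrite (exchange_big_dep predT) //=; apply: eq_bigr => j _.
rewrite /cauchy mulr_suml.
rewrite (eq_bigl (fun i : 'I_n.+1 => (i <= n - j)%N)); last first.
  move=> i; have hi := ltn_ord i; have hj := ltn_ord j; rewrite !ltnS in hi hj.
  by rewrite !leq_subRL // addnC.
rewrite (big_ord_narrow_leq (leq_subr j n)).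
by apply: eq_bigr => i _; rewrite /f /= mulrA.
Qed.

Fact series_mul1 : left_id series_one series_mul.
Proof.
move=> x; apply/funext => n; rewrite /series_mul /cauchy big_ord_recl subn0.
by rewrite mul1r big1 ?addr0 // => i _; rewrite mul0r.
Qed.
Fact series_mulr1 : right_id series_one series_mul.
Proof.
move=> x; apply/funext => n; rewrite series_mulE_rev big_ord_recl subn0.
by rewrite mulr1 big1 ?addr0 // => i _; rewrite mulr0.
Qed.
Fact series_mulDl : left_distributive series_mul +%R.
Proof.
move=> x y z; apply/funext => n; rewrite series_coefD /series_mul /cauchy.
by rewrite -big_split; apply: eq_bigr => i _; rewrite /= mulrDl.
Qed.
Fact series_mulDr : right_distributive series_mul +%R.
Proof.
move=> x y z; apply/funext => n; rewrite series_coefD /series_mul /cauchy.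
by rewrite -big_split; apply: eq_bigr => i _; rewrite /= mulrDr.
Qed.
Fact series_one_neq0 : series_one != 0.
Proof.
by apply/eqP => /(congr1 (fun x => x 0%N)) /eqP; rewrite oner_eq0.
Qed.

HB.instance Definition _ := GRing.Zmodule_isNzRing.Build (series R)
  series_mulA series_mul1 series_mulr1 series_mulDl series_mulDr series_one_neq0.

Lemma series_coefM x y n : (x * y) n = \sum_(i < n.+1) x i * y (n - i)%N.
Proof. by []. Qed.

Lemma series_coef1 n : (1 : series R) n = (n == 0%N)%:R.
Proof. by []. Qed.

End SeriesRing.

Section SeriesAlgebra.
Variables (k : fieldType) (B : algType k).

Fact series_scaleAl (c : k) (x y : series B) : c *: (x * y) = (c *: x) * y.
Proof.
apply/funext => n; rewrite series_coefZ !series_coefM scaler_sumr.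
by apply: eq_bigr => i _; rewrite scalerAl.
Qed.
HB.instance Definition _ :=
  GRing.Lmodule_isLalgebra.Build k (series B) series_scaleAl.

Fact series_scaleAr (c : k) (x y : series B) : c *: (x * y) = x * (c *: y).
Proof.
apply/funext => n; rewrite series_coefZ !series_coefM scaler_sumr.
by apply: eq_bigr => i _; rewrite scalerAr.
Qed.
HB.instance Definition _ :=
  GRing.Lalgebra_isAlgebra.Build k (series B) series_scaleAr.

End SeriesAlgebra.

(* Convergence for the λ-adic topology. *)
Definition adic_cvg (V : Type) (s : nat -> series V) (x : series V) : Prop :=
  forall n, exists N, forall m, (N <= m)%N -> s m n = x n.

(* The sum of the family (f l)_l when f l is divisible by λ^l for all l: no    *)
(* index l > n then contributes to the coefficient of λ^n.                     *)
Definition adic_sum (V : zmodType) (f : nat -> series V) : series V :=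
  fun n => \sum_(l < n.+1) f l n.

Lemma adic_sum_cvg (V : zmodType) (f : nat -> series V) :
  (forall l n, (n < l)%N -> f l n = 0) ->
  adic_cvg (fun m => \sum_(l < m) f l) (adic_sum f).
Proof.
move=> f0 n; exists n.+1 => m lt_nm; rewrite series_coef_sum /adic_sum.
rewrite (big_ord_widen m (fun l => f l n) lt_nm) [LHS]big_mkcond [RHS]big_mkcond /=.
by apply: eq_bigr => l _; case: ltnP => // /f0.
Qed.

Section Fer.
Variables (k : fieldType) (A : dendriformType k).
Local Notation Abar := (augm A).
Implicit Types (x y : series Abar) (a : A).

Definition lam a : series Abar := fun n => if n == 1%N then aug_in a else 0.

Definition sprec x y : series Abar := cauchy (@aug_prec k A) x y.
Definition ssucc x y : series Abar := cauchy (@aug_succ k A) x y.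
Definition prelie x y : series Abar := ssucc x y - sprec y x.

Definition sexp x : series Abar := adic_sum (fun n => (n`!%:R^-1 : k) *: x ^+ n).

(* The summand of index l = 0 vanishes. *)
Definition fer x : series Abar :=
  adic_sum (fun l =>
    ((-1) ^+ l * l%:R / (l.+1)`!%:R : k) *: iter l (prelie x) x).

Lemma coef_sexpr_small x l n : x 0%N = 0 -> (n < l)%N -> (x ^+ l) n = 0.
Proof.
move=> x0; elim: l n => // l IHl n lt_nl; rewrite exprS series_coefM.
apply: big1 => -[[|i] /= lt_in] _; first by rewrite x0 mul0r.
case: n lt_nl lt_in => // n lt_nl _; rewrite IHl ?mulr0 // subSS.
by move: lt_nl; rewrite ltnS; apply: leq_ltn_trans; exact: leq_subr.
Qed.

Lemma coef_iter_prelie_small x l n :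
  x 0%N = 0 -> (n <= l)%N -> iter l (prelie x) x n = 0.
Proof.
move=> x0; elim: l n => [|l IHl] n le_nl; first by move: le_nl; case: n.
set v := iter l _ x in IHl; change (ssucc x v n - sprec v x n = 0).
rewrite [X in X - _]big1 ?[X in _ - X]big1 ?subr0 // => -[i /= lt_in] _.
- have [le_il|lt_li] := leqP i l.
    by rewrite IHl // /aug_prec /= linear0l scaler0 addr0.
  have -> : (n - i)%N = 0%N by apply/eqP; rewrite subn_eq0 (leq_trans le_nl).
  by rewrite x0 /aug_prec /= linear0r scale0r addr0.
- case: i lt_in => [|i] lt_in.
    by rewrite x0 /aug_succ /= linear0l scale0r addr0.
  rewrite IHl ?/aug_succ /= ?linear0r ?scaler0 ?addr0 //.
  by rewrite leq_subLR (leq_trans le_nl) // addSn ltnS leq_addl.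
Qed.

Lemma sexp_cvg x : x 0%N = 0 ->
  adic_cvg (fun m => \sum_(n < m) (n`!%:R^-1 : k) *: x ^+ n) (sexp x).
Proof.
move=> x0; apply: (@adic_sum_cvg _ (fun n => n`!%:R^-1 *: x ^+ n)) => l n ltnl.
by rewrite series_coefZ coef_sexpr_small ?scaler0.
Qed.

Lemma fer_cvg x : x 0%N = 0 ->
  adic_cvg (fun m => \sum_(l < m)
    ((-1) ^+ l * l%:R / (l.+1)`!%:R : k) *: iter l (prelie x) x) (fer x).
Proof.
move=> x0; apply: (@adic_sum_cvg _ (fun l =>
  ((-1) ^+ l * l%:R / (l.+1)`!%:R : k) *: iter l (prelie x) x)) => l n ltnl.
by rewrite series_coefZ coef_iter_prelie_small ?scaler0 // ltnW.
Qed.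

End Fer.

Notation "x ≺ y" := (sprec x y) : dendriform_scope.
Notation "x ≻ y" := (ssucc x y) : dendriform_scope.

(* Main.v *)
(* Fix [u] in [λA[[λ]]] and put E = exp(u), L = L_▷[u].  If R = 1 + u ≺ R, then
   R' = exp(-u) * R satisfies R' = 1 + ((E^-1 + E^-1 ≻ u) ≺ E) ≺ R'.  Comparing the
   parts of degree n in u of exp(-tu) and exp(tu) (formally: differentiating in t)
   gives (E^-1 ≻ u) ≺ E = exp(-L)(u) = Σ (-1)^l L^l(u) / l! and
   E^-1 ≺ E = - Σ (-1)^l L^l(u) / (l+1)!, whose sum is the Fer series of u.  So the
   remainders R_n = exp(-U_(n-1)) * ... * exp(-U_0) * X solve R_n = 1 + U_n ≺ R_n when U
   obeys the recursion, and they tend to 1 because U_n is divisible by λ^(n+1).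
   Conversely R determines u in R = 1 + u ≺ R among the series without component along
   the unit, and U_n is such a series since exp(U_n) = R_n * R_(n+1)^-1 has scalar part 1. *)
From HB Require Import structures.
Require Import Defs.
From mathcomp Require Import all_boot all_order all_algebra.
From mathcomp Require Import sesquilinear.
From mathcomp Require Import boolp functions.
Import GRing.Theory.
Local Open Scope ring_scope.
Local Open Scope dendriform_scope.

Set Implicit Arguments.
Unset Strict Implicit.
Unset Printing Implicit Defensive.

(** * Finite sums over triangles and the Leibniz rule on coefficients *)

Lemma sum_triangle (V : zmodType) (F : nat -> nat -> V) N :
  \sum_(i < N) \sum_(j < N - i) F i j = \sum_(m < N) \sum_(i < m.+1) F i (m - i)%N.
Proof.
elim: N => [|N IHN]; first by rewrite !big_ord0.
rewrite [RHS]big_ord_recr /= -IHN [LHS]big_ord_recr [in RHS]big_ord_recr /= subSnn.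
rewrite subnn big_ord1 addrA -big_split /=; congr (_ + _); apply: eq_bigr => i _.
by rewrite subSn ?big_ord_recr // ltnW.
Qed.

Section ProductRule.
Variables (k : fieldType) (V : lmodType k).

(** If [T i j] pairs the t^i and t^j coefficients of two factors, this is the Leibniz rule for d/dt:
    the weight [n.+1] splits as [i] plus [n.+1 - i], one share per factor. *)
Lemma sum_product_rule (T : nat -> nat -> V) n :
  (n.+1)%:R *: \sum_(i < n.+2) T i (n.+1 - i)%N =
  \sum_(i < n.+1) (i.+1)%:R *: T i.+1 (n - i)%N +
  \sum_(i < n.+1) ((n - i).+1)%:R *: T i (n - i).+1.
Proof.
rewrite scaler_sumr (eq_bigr (fun i : 'I_n.+2 => i%:R *: T i (n.+1 - i)%N +
  (n.+1 - i)%:R *: T i (n.+1 - i)%N)); last first.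
  by move=> i _; rewrite -scalerDl -natrD subnKC // -ltnS.
rewrite big_split /=; congr (_ + _).
  by rewrite big_ord_recl /= scale0r add0r.
rewrite big_ord_recr /= subnn scale0r addr0; apply: eq_bigr => i _.
by rewrite subSn // -ltnS.
Qed.

End ProductRule.

(** * Cauchy products along an arbitrary bilinear operation, and λ-adic sums *)

Section Cauchy.
Variables (k : fieldType) (V : lmodType k).
Implicit Types (op : {bilinear V -> V -> V}) (x y z : series V).

(** Divisibility of [x] by λ^m. *)
Definition ord_ge m x := forall n, (n < m)%N -> x n = 0.

Lemma cauchyE op x y n :
  cauchy op x y n = \sum_(i < n.+1) op (x i) (y (n - i)%N).
Proof. by []. Qed.

Lemma cauchyE_rev op x y n :
  cauchy op x y n = \sum_(i < n.+1) op (x (n - i)%N) (y i).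
Proof.
rewrite /cauchy (reindex_inj rev_ord_inj) /=.
by apply: eq_bigr => i _; rewrite (sub_ordK i).
Qed.

Lemma cauchyPl op z c x y : cauchy op (c *: x + y) z = c *: cauchy op x z + cauchy op y z.
Proof.
apply/funext => n; rewrite [RHS]series_coefD series_coefZ !cauchyE scaler_sumr.
rewrite -big_split /=; apply: eq_bigr => i _.
by rewrite series_coefD series_coefZ linearPl.
Qed.

Lemma cauchyPr op z c x y : cauchy op z (c *: x + y) = c *: cauchy op z x + cauchy op z y.
Proof.
apply/funext => n; rewrite [RHS]series_coefD series_coefZ !cauchyE scaler_sumr.
rewrite -big_split /=; apply: eq_bigr => i _.
by rewrite series_coefD series_coefZ linearPr.
Qed.

Fact cauchy_is_bilinear op :
  bilinear_for *:%R *:%R (cauchy op : series V -> series V -> series V).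
Proof. by split=> z c x y; [exact: cauchyPl | exact: cauchyPr]. Qed.

HB.instance Definition _ op :=
  bilinear_isBilinear.Build k (series V) (series V) (series V) *:%R *:%R
    (cauchy op) (cauchy_is_bilinear op).

Lemma cauchyDl op x y z : cauchy op (x + y) z = cauchy op x z + cauchy op y z.
Proof. exact: linearDl. Qed.

Lemma cauchyDr op x y z : cauchy op z (x + y) = cauchy op z x + cauchy op z y.
Proof. exact: linearDr. Qed.

Lemma cauchyZl op (c : k) x y : cauchy op (c *: x) y = c *: cauchy op x y.
Proof. exact: linearZl_LR. Qed.

Lemma cauchyZr op (c : k) x y : cauchy op x (c *: y) = c *: cauchy op x y.
Proof. exact: linearZr_LR. Qed.

Lemma cauchyNl op x y : cauchy op (- x) y = - cauchy op x y.
Proof. exact: linearNl. Qed.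

Lemma cauchy_sumlz op n (F : 'I_n -> series V) x :
  cauchy op (\sum_(i < n) F i) x = \sum_(i < n) cauchy op (F i) x.
Proof. exact: linear_sumlz. Qed.

Lemma cauchy_sumr op n (F : 'I_n -> series V) x :
  cauchy op x (\sum_(i < n) F i) = \sum_(i < n) cauchy op x (F i).
Proof. exact: linear_sumr. Qed.

Lemma ord_ge_cauchy op p q x y :
  ord_ge p x -> ord_ge q y -> ord_ge (p + q) (cauchy op x y).
Proof.
move=> xp yq n lt_n; rewrite cauchyE big1 // => i _.
have [lt_ip|le_pi] := ltnP i p; first by rewrite xp // linear0l.
rewrite yq ?linear0r // ltn_subLR; last by rewrite -ltnS.
by rewrite (leq_trans lt_n) // leq_add2r.
Qed.

(** Four separate operations make each of the three dendriform axioms an instance. Both sides are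
    the sum of [f i j] over [i + j <= n], in the two orders of summation. *)
Lemma cauchyA (op1 op2 op3 op4 : {bilinear V -> V -> V}) :
  (forall u v w, op1 (op2 u v) w = op3 u (op4 v w)) ->
  forall x y z, cauchy op1 (cauchy op2 x y) z = cauchy op3 x (cauchy op4 y z).
Proof.
move=> opA x y z; apply/funext => n; rewrite cauchyE_rev cauchyE.
pose f i j := op3 (x i) (op4 (y (n - j - i)%N) (z j)).
transitivity (\sum_(j < n.+1) \sum_(i < n.+1 | (i <= n - j)%N) f i j).
  apply: eq_bigr => j _; rewrite cauchyE linear_sumlz.
  rewrite (big_ord_narrow_leq (leq_subr j n)) /f.
  by apply: eq_bigr => i _; rewrite /= opA.
rewrite (exchange_big_dep predT) //=; apply: eq_bigr => i _.
rewrite cauchyE_rev linear_sumr.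
rewrite (eq_bigl (fun j : 'I_n.+1 => (j <= n - i)%N)); last first.
  move=> j; have hi := ltn_ord i; have hj := ltn_ord j; rewrite !ltnS in hi hj.
  by rewrite !leq_subRL // addnC.
rewrite (big_ord_narrow_leq (leq_subr i n)).
by apply: eq_bigr => j _; rewrite /f /= subnAC.
Qed.

Lemma adic_sum_trunc (f : nat -> series V) n N :
  (forall l, ord_ge l (f l)) -> (n < N)%N -> adic_sum f n = (\sum_(l < N) f l) n.
Proof.
move=> f0 lt_nN; rewrite series_coef_sum /adic_sum.
rewrite (big_ord_widen N (fun l => f l n) lt_nN) [LHS]big_mkcond /=.
by apply: eq_bigr => l _; case: ltnP => // /f0.
Qed.

Lemma cauchy_adic_suml op (e : nat -> series V) x :
  (forall l, ord_ge l (e l)) ->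
  cauchy op (adic_sum e) x = adic_sum (fun l => cauchy op (e l) x).
Proof.
move=> e0; apply/funext => n.
transitivity (cauchy op (\sum_(i < n.+1) e i) x n); last first.
  by rewrite cauchy_sumlz series_coef_sum.
by apply: eq_bigr => i _; rewrite (adic_sum_trunc e0 (ltn_ord i)).
Qed.

(** At λ^n both sums may be cut at the same bound; the square of index pairs and the triangle
    [i + j <= n] then differ only by terms of order above n. *)
Lemma cauchy_adic_sum op (e g : nat -> series V) :
  (forall l, ord_ge l (e l)) -> (forall l, ord_ge l (g l)) ->
  cauchy op (adic_sum e) (adic_sum g) =
  adic_sum (fun m => \sum_(i < m.+1) cauchy op (e i) (g (m - i)%N)).
Proof.
move=> e0 g0; apply/funext => n.
transitivity (cauchy op (\sum_(i < n.+1) e i) (\sum_(j < n.+1) g j) n).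
  apply: eq_bigr => i _; rewrite (adic_sum_trunc e0 (ltn_ord i)).
  by rewrite (@adic_sum_trunc g _ n.+1) // ltnS leq_subr.
rewrite linear_sumlz series_coef_sum /adic_sum.
rewrite [RHS](eq_bigr (fun m : 'I_n.+1 =>
  \sum_(i < m.+1) cauchy op (e i) (g (m - i)%N) n)); last first.
  by move=> m _; rewrite series_coef_sum.
rewrite -(sum_triangle (fun i j => cauchy op (e i) (g j) n)).
apply: eq_bigr => i _; rewrite linear_sumr series_coef_sum.
rewrite (big_ord_widen n.+1 (fun j => cauchy op (e i) (g j) n) (leq_subr i n.+1)).
rewrite [RHS]big_mkcond; apply: eq_bigr => j _; case: ltnP => // le_nij.
rewrite /= (ord_ge_cauchy op (e0 i) (g0 j)) //.
by move: le_nij; rewrite leq_subLR.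
Qed.

End Cauchy.

(** * The dendriform axioms on the augmentation and on its series *)

Section AugmentedDendriform.
Variables (k : fieldType) (A : dendriformType k).
Implicit Types (u v w : augm A) (x y z : series (augm A)).

Fact aug_prec_is_bilinear : bilinear_for *:%R *:%R (@aug_prec k A).
Proof.
split=> w c u v; apply: injective_projections; rewrite /= ?scaler0 ?addr0 //.
  by rewrite linearPl /= !scalerDr !scalerA [_ * c]mulrC addrACA.
by rewrite linearPr /= !scalerDl !scalerDr scalerA addrACA.
Qed.

HB.instance Definition _ := bilinear_isBilinear.Build k (augm A) (augm A) (augm A)
  *:%R *:%R (@aug_prec k A) aug_prec_is_bilinear.

Fact aug_succ_is_bilinear : bilinear_for *:%R *:%R (@aug_succ k A).
Proof.
split=> w c u v; apply: injective_projections; rewrite /= ?scaler0 ?addr0 //.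
  by rewrite linearPl /= !scalerDl !scalerDr scalerA addrACA.
by rewrite linearPr /= !scalerDr !scalerA [_ * c]mulrC addrACA.
Qed.

HB.instance Definition _ := bilinear_isBilinear.Build k (augm A) (augm A) (augm A)
  *:%R *:%R (@aug_succ k A) aug_succ_is_bilinear.

Fact aug_mul_is_bilinear : bilinear_for *:%R *:%R (@aug_mul k A).
Proof.
split=> w c u v.
  by rewrite -[LHS]/((c *: u + v) * w) mulrDl -scalerAl.
by rewrite -[LHS]/(w * (c *: u + v)) mulrDr -scalerAr.
Qed.

HB.instance Definition _ := bilinear_isBilinear.Build k (augm A) (augm A) (augm A)
  *:%R *:%R (@aug_mul k A) aug_mul_is_bilinear.

(** With the value 0 for 1 ≺ 1 and 1 ≻ 1 the three axioms hold on the whole augmentation, provided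
    the product is [aug_mul], which at 1 * 1 is not the sum of the half-products. *)
Lemma aug_precA u v w : aug_prec (aug_prec u v) w = aug_prec u (aug_mul v w).
Proof.
congr pair; rewrite /= linearDl /= dprecA -/(dstar _ _) !linearDr /=.
rewrite !linearZr_LR !linearZl_LR /= scalerDr scalerA.
by rewrite [v.2 * w.2]mulrC -!addrA.
Qed.

Lemma aug_succ_prec u v w : aug_prec (aug_succ u v) w = aug_succ u (aug_prec v w).
Proof.
congr pair; rewrite /= linearDl linearDr /= dsuccprecA !scalerDr !scalerA.
by rewrite linearZl_LR linearZr_LR [w.2 * _]mulrC addrACA.
Qed.

Lemma aug_succA u v w : aug_succ (aug_mul u v) w = aug_succ u (aug_succ v w).
Proof.
congr pair; rewrite /= linearDr /= dsuccA -/(dstar _ _) !linearDl /=.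
rewrite !linearZl_LR !linearZr_LR scalerDr scalerA addrA.
by congr (_ + _); apply: addrAC.
Qed.

Lemma sprecA x y z : (x ≺ y) ≺ z = x ≺ (y * z).
Proof. exact: (cauchyA aug_precA). Qed.

Lemma ssuccprecA x y z : (x ≻ y) ≺ z = x ≻ (y ≺ z).
Proof. exact: (cauchyA aug_succ_prec). Qed.

Lemma ssuccA x y z : (x * y) ≻ z = x ≻ (y ≻ z).
Proof. exact: (cauchyA aug_succA). Qed.

End AugmentedDendriform.

(** * Series in A[[λ]] and the rules for the unit *)

Section AugmentedIdeal.
Variables (k : fieldType) (A : dendriformType k).
Implicit Types (u v w : augm A) (x y z : series (augm A)).

(* [x] lies in [A[[λ]]], i.e. has no component along the unit. *)
Definition unitfree x := forall n, (x n).2 = 0.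

Lemma aug_eqP u v : u.1 = v.1 -> u.2 = v.2 -> u = v.
Proof. exact: injective_projections. Qed.

Lemma snd_sum I (r : seq I) (P : pred I) (F : I -> augm A) :
  (\sum_(i <- r | P i) F i).2 = \sum_(i <- r | P i) (F i).2.
Proof. exact: (big_morph (fun u : augm A => u.2)). Qed.

Lemma unitfreeP x : unitfree x -> forall n, x n = aug_in (x n).1.
Proof. by move=> x0 n; apply: aug_eqP; rewrite //= x0. Qed.

Lemma unitfreeD x y : unitfree x -> unitfree y -> unitfree (x + y).
Proof. by move=> x0 y0 n; rewrite series_coefD /= x0 y0 addr0. Qed.

Lemma unitfreeN x : unitfree x -> unitfree (- x).
Proof. by move=> x0 n; rewrite -[(- x) n]/(- (x n)) /= x0 oppr0. Qed.

Lemma unitfreeZ (c : k) x : unitfree x -> unitfree (c *: x).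
Proof. by move=> x0 n; rewrite series_coefZ /= x0 scaler0. Qed.

Lemma unitfree_sprec x y : unitfree (x ≺ y).
Proof. by move=> n; rewrite /sprec /cauchy snd_sum big1. Qed.

Lemma unitfree_ssucc x y : unitfree (x ≻ y).
Proof. by move=> n; rewrite /ssucc /cauchy snd_sum big1. Qed.

Lemma snd_coefM x y n : ((x * y) n).2 = \sum_(i < n.+1) (x i).2 * (y (n - i)%N).2.
Proof. by rewrite series_coefM snd_sum. Qed.

Lemma unitfreeMr x y : unitfree y -> unitfree (x * y).
Proof. by move=> y0 n; rewrite snd_coefM big1 // => i _; rewrite y0 mulr0. Qed.

(** The two sides differ only by the product of the scalar parts, which vanishes as soon as one
    factor is unit-free. *)
Lemma mul_dend x y : unitfree x \/ unitfree y -> x * y = x ≺ y + x ≻ y.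
Proof.
move=> xy0; apply/funext => n; rewrite series_coefD series_coefM -big_split /=.
apply: eq_bigr => i _; apply: aug_eqP => /=.
  by rewrite /dstar -addrA [X in _ + X]addrC -addrA [X in _ + X]addrCA !addrA.
by case: xy0 => ->; rewrite ?mul0r ?mulr0 addr0.
Qed.

Lemma coef1_fst n : ((1 : series (augm A)) n).1 = 0.
Proof. by rewrite series_coef1; case: n. Qed.

Lemma coef1_snd n : ((1 : series (augm A)) n).2 = (n == 0%N)%:R.
Proof. by rewrite series_coef1; case: n. Qed.

Lemma sprec1l x : 1 ≺ x = 0.
Proof.
apply/funext => n; rewrite /sprec /cauchy big1 // => i _; apply: aug_eqP => //=.
by rewrite coef1_fst linear0l scaler0 addr0.
Qed.

Lemma ssucc1r x : x ≻ 1 = 0.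
Proof.
apply/funext => n; rewrite /ssucc /cauchy big1 // => i _; apply: aug_eqP => //=.
by rewrite coef1_fst linear0r scaler0 addr0.
Qed.

Lemma sprec1r x : unitfree x -> x ≺ 1 = x.
Proof. by move=> x0; rewrite -[RHS]mulr1 mul_dend ?ssucc1r ?addr0 //; left. Qed.

Lemma ssucc1l x : unitfree x -> 1 ≻ x = x.
Proof. by move=> x0; rewrite -[RHS]mul1r mul_dend ?sprec1l ?add0r //; right. Qed.

Lemma sprec_suml n (F : 'I_n -> series (augm A)) x :
  (\sum_(i < n) F i) ≺ x = \sum_(i < n) (F i ≺ x).
Proof. exact: cauchy_sumlz. Qed.

Lemma ssucc_sumr n (F : 'I_n -> series (augm A)) x :
  x ≻ (\sum_(i < n) F i) = \sum_(i < n) (x ≻ F i).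
Proof. exact: cauchy_sumr. Qed.

Lemma sprecZl (c : k) x y : (c *: x) ≺ y = c *: (x ≺ y).
Proof. exact: cauchyZl. Qed.

Lemma sprecZr (c : k) x y : x ≺ (c *: y) = c *: (x ≺ y).
Proof. exact: cauchyZr. Qed.

Lemma ssuccZl (c : k) x y : (c *: x) ≻ y = c *: (x ≻ y).
Proof. exact: cauchyZl. Qed.

Lemma ssuccZr (c : k) x y : x ≻ (c *: y) = c *: (x ≻ y).
Proof. exact: cauchyZr. Qed.

Lemma sprecDl x y z : (x + y) ≺ z = (x ≺ z) + (y ≺ z).
Proof. exact: cauchyDl. Qed.

Lemma sprecDr x y z : x ≺ (y + z) = (x ≺ y) + (x ≺ z).
Proof. exact: cauchyDr. Qed.

Lemma sprecNl x y : (- x) ≺ y = - (x ≺ y).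
Proof. exact: cauchyNl. Qed.

Lemma ssuccNl x y : (- x) ≻ y = - (x ≻ y).
Proof. exact: cauchyNl. Qed.

Lemma prelieE x y : prelie x y = x ≻ y - y ≺ x.
Proof. by []. Qed.

Lemma prelieZr (c : k) x y : prelie x (c *: y) = c *: prelie x y.
Proof. by rewrite !prelieE ssuccZr sprecZl scalerBr. Qed.

Lemma unitfree_prelie x y : unitfree (prelie x y).
Proof. by apply: unitfreeD; [apply: unitfree_ssucc|apply/unitfreeN/unitfree_sprec]. Qed.

Lemma unitfree_lam (a : A) : unitfree (lam a).
Proof. by rewrite /lam => n; case: eqP. Qed.

Lemma unitfree_adic_sum (f : nat -> series (augm A)) :
  (forall l, unitfree (f l)) -> unitfree (adic_sum f).
Proof. by move=> f0 n; rewrite /adic_sum snd_sum big1 // => i _; rewrite f0. Qed.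

Lemma unitfree_fer x : unitfree (fer x).
Proof.
apply: unitfree_adic_sum => -[|l].
  (* The iterate of index 0 is [x] itself, about which nothing is assumed; its coefficient is 0. *)
  by rewrite mulr0 mul0r scale0r.
exact/unitfreeZ/unitfree_prelie.
Qed.

End AugmentedIdeal.

(** * Exponentials and their inverses *)

Section Fer.
Variables (k : fieldType) (A : dendriformType k).
Hypothesis char_k : [pchar k] =i pred0.
Implicit Types (x y z u : series (augm A)).

Lemma natk_neq0 n : n.+1%:R != 0 :> k.
Proof. by rewrite (iffLR (pcharf0P k) char_k). Qed.

(** The coefficient of t^n in exp(tx). Multiplying it by n turns into d/dt, so that [exptermSr] and
    [exptermS] are the two forms of the derivative of exp(tx). *)
Definition expterm x n : series (augm A) := (n`!%:R^-1 : k) *: x ^+ n.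

Lemma sexpE x : sexp x = adic_sum (expterm x).
Proof. by []. Qed.

Lemma expterm0 x : expterm x 0 = 1.
Proof. by rewrite /expterm expr0 invr1 scale1r. Qed.

Lemma ord_ge_expterm x l : x 0%N = 0 -> ord_ge l (expterm x l).
Proof. by move=> x0 n lt_nl; rewrite /expterm series_coefZ coef_sexpr_small ?scaler0. Qed.

Lemma natS_scale_invfact n x : n.+1%:R *: (((n.+1)`!%:R^-1 : k) *: x) = (n`!%:R^-1 : k) *: x.
Proof. by rewrite scalerA factS natrM invfM mulrA divff ?mul1r ?natk_neq0. Qed.

Lemma exptermSr x n : n.+1%:R *: expterm x n.+1 = expterm x n * x.
Proof. by rewrite /expterm natS_scale_invfact exprSr scalerAl. Qed.

Lemma exptermS x n : n.+1%:R *: expterm x n.+1 = x * expterm x n.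
Proof. by rewrite /expterm natS_scale_invfact exprS scalerAr. Qed.

Lemma scale_natS_inj n x y : n.+1%:R *: x = n.+1%:R *: y :> series (augm A) -> x = y.
Proof. by move/(congr1 ( *:%R n.+1%:R^-1)); rewrite !scalerA mulVf ?natk_neq0 // !scale1r. Qed.

Lemma oppr_coef x n : (- x) n = - x n. Proof. by []. Qed.

Lemma sexpNK x : x 0%N = 0 -> sexp (- x) * sexp x = 1.
Proof.
move=> x0.
have Nx0 : (- x) 0%N = 0 by rewrite oppr_coef x0 oppr0.
pose e := expterm (- x); pose g := expterm x.
have -> : sexp (- x) * sexp x = adic_sum (fun n => \sum_(i < n.+1) e i * g (n - i)%N).
  exact: (@cauchy_adic_sum k (augm A) (@aug_mul k A) e g
     (fun l => ord_ge_expterm Nx0) (fun l => ord_ge_expterm x0)).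
(* Times [n.+1], this is a coefficient of the derivative of exp(-tx) * exp(tx), whose two halves
   cancel. *)
have G0 n : \sum_(i < n.+2) e i * g (n.+1 - i)%N = 0.
  apply: (@scale_natS_inj n); rewrite scaler0.
  rewrite (sum_product_rule (fun i j => e i * g j)) -big_split /= big1 // => i _.
  by rewrite scalerAl scalerAr exptermSr exptermS mulrN mulNr mulrA addNr.
apply/funext => n; rewrite /adic_sum big_ord_recl big_ord1 /= /e /g !expterm0 mulr1.
by rewrite big1 ?addr0 // => i _; rewrite G0.
Qed.

Lemma sexpKN x : x 0%N = 0 -> sexp x * sexp (- x) = 1.
Proof.
by move=> x0; rewrite -{1}[x]opprK sexpNK // oppr_coef x0 oppr0.
Qed.

Lemma unitfree_sexpB1 x : unitfree x -> unitfree (sexp x - 1).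
Proof.
move=> x0 n; rewrite series_coefD oppr_coef /=.
rewrite sexpE /adic_sum snd_sum big_ord_recl [X in _ + X - _]big1 ?addr0.
  by rewrite expterm0 subrr.
by move=> i _; rewrite /expterm exprSr; apply/unitfreeZ/unitfreeMr.
Qed.

(** * One step of the recursion: the Fer series in closed form *)

Section Step.
Variable u : series (augm A).
Hypotheses (u_free : unitfree u) (u0 : u 0%N = 0).
Let e := expterm (- u).
Let g := expterm u.
(** The coefficients of t^n in (exp(-tu) ≻ u) ≺ exp(tu) and, for [comp_part], in exp(-tu) ≺
    exp(tu). *)
Let conj_part n := \sum_(i < n.+1) ((e i ≻ u) ≺ g (n - i)%N).
Let comp_part n := \sum_(i < n.+1) (e i ≺ g (n - i)%N).

(** The generating function C(t) solves C' = -L(C) with C(0) = u. *)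
Lemma conjE n : conj_part n = ((-1) ^+ n / n`!%:R : k) *: iter n (prelie u) u.
Proof.
elim: n => [|n IHn].
  rewrite /conj_part big_ord1 /e /g !expterm0 ssucc1l // sprec1r //.
  by rewrite expr0 invr1 mulr1 scale1r.
apply: (@scale_natS_inj n).
rewrite (sum_product_rule (fun i j => (e i ≻ u) ≺ g j)).
(* The derivative of exp(tu) appends [u] on the right through [sprecA]; that of exp(-tu) brings [-u]
   to the far left through [ssuccA] and [ssuccprecA]. *)
transitivity (- prelie u (conj_part n)).
  rewrite prelieE /conj_part ssucc_sumr sprec_suml opprB addrC; congr (_ + _).
    by apply: eq_bigr => i _; rewrite -sprecZr exptermSr sprecA.
  rewrite -sumrN; apply: eq_bigr => i _.
  by rewrite -sprecZl -ssuccZl exptermS mulNr ssuccNl sprecNl ssuccA ssuccprecA.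
rewrite IHn prelieZr -scaleNr -iterS scalerA factS natrM invfM.
by rewrite mulrCA mulVKf ?natk_neq0 // exprS mulN1r mulNr.
Qed.

(** The derivative of exp(-tu) gives -([e i] * u), split by [mul_dend]; its ≺ half cancels against
    the derivative of exp(tu), and the ≻ half remains. *)
Lemma compS n : n.+1%:R *: comp_part n.+1 = - conj_part n.
Proof.
rewrite (sum_product_rule (fun i j => e i ≺ g j)) -big_split /= -sumrN.
apply: eq_bigr => i _.
rewrite -sprecZl -sprecZr exptermSr exptermS mulrN sprecNl.
rewrite (@mul_dend _ _ (e i) u); last by right; exact: u_free.
by rewrite sprecDl opprD sprecA addrAC addNr add0r.
Qed.

Lemma ferE : fer u = (sexp (- u) ≺ sexp u) + ((sexp (- u) ≻ u) ≺ sexp u).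
Proof.
have Nu0 : (- u) 0%N = 0 by rewrite oppr_coef u0 oppr0.
have e0 l : ord_ge l (e l) := ord_ge_expterm Nu0.
have g0 l : ord_ge l (g l) := ord_ge_expterm u0.
have -> : sexp (- u) ≺ sexp u = adic_sum comp_part by exact: (cauchy_adic_sum (@aug_prec k A) e0 g0).
have -> : sexp (- u) ≻ u = adic_sum (fun l => e l ≻ u).
  exact: (cauchy_adic_suml (@aug_succ k A) u e0).
have -> : adic_sum (fun l => e l ≻ u) ≺ sexp u = adic_sum conj_part.
  have eu0 l : ord_ge l (e l ≻ u).
    have u_ge0 : ord_ge 0 u by [].
    by rewrite -{1}[l]addn0; exact: (ord_ge_cauchy (@aug_succ k A) (e0 l) u_ge0).
  exact: (cauchy_adic_sum (@aug_prec k A) eu0 g0).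
apply/funext => n; rewrite series_coefD /adic_sum.
have conj_part_n : conj_part n n = 0.
  by rewrite conjE series_coefZ coef_iter_prelie_small ?scaler0.
(* [comp_part 0] is 1 ≺ 1 = 0, so [compS] shifts the index by one. The extra top term on the right
   vanishes by [conj_part_n], as [conj_part n] is divisible by λ^(n+1). *)
have -> : \sum_(l < n.+1) comp_part l n = \sum_(l < n.+1) (- (l.+1%:R^-1 *: conj_part l)) n.
  rewrite big_ord_recl [RHS]big_ord_recr /= oppr_coef series_coefZ conj_part_n.
  rewrite scaler0 oppr0 addr0 /comp_part big_ord1 /e expterm0 sprec1l add0r.
  apply: eq_bigr => l _; congr (_ n); rewrite -[LHS]scale1r.
  by rewrite -[in LHS](@mulVf _ l.+1%:R) ?natk_neq0 // -scalerA compS scalerN.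
rewrite -big_split /=; apply: eq_bigr => l _.
rewrite -series_coefD; congr (_ n); rewrite conjE scalerA -scaleNr -scalerDl.
(* What remains is (-1)^l/l! - (-1)^l/(l+1)! = (-1)^l l/(l+1)!. *)
congr (_ *: _); rewrite factS natrM invfM.
rewrite -[X in _ = _ + X](@mulVKf _ l.+1%:R) ?natk_neq0 //.
rewrite -mulNr -[l.+1%:R in RHS]natr1 mulrDl mul1r.
by rewrite mulNr addrCA addNr addr0 natr1 [_ * l%:R]mulrC -mulrA [X in _ * X]mulrCA.
Qed.

(** Inserting the equation for x into E * x gives 1 + E ≺ x + (E ≻ u) ≺ x. Writing x as exp(u) * (E
    * x) and applying [sprecA] then exhibits the two summands of [ferE]. *)
Lemma sexp_step x : x = 1 + (u ≺ x) ->
  sexp (- u) * x = 1 + (fer u ≺ sexp (- u) * x).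
Proof.
move=> xE; set E := sexp (- u).
have EK : sexp u * (E * x) = x by rewrite mulrA sexpKN // mul1r.
(* The unit part of [E], equal to 1, is lost because 1 ≺ 1 = 0. *)
have E1 : E ≺ 1 = E - 1.
  rewrite -[X in X ≺ 1](subrK 1) sprecDl sprec1l addr0 sprec1r //.
  exact/unitfree_sexpB1/unitfreeN.
rewrite ferE -/E; move: E (sexp u) EK E1 => {}E F EK E1.
rewrite sprecDl (sprecA E) (sprecA (E ≻ u)) EK.
rewrite {1}xE mulrDr mulr1 mul_dend; last by right; apply: unitfree_sprec.
have -> : E ≺ (u ≺ x) = (E ≺ x) - (E - 1).
  by rewrite {2}xE sprecDr E1 addrAC subrr add0r.
rewrite ssuccprecA !addrA; congr (_ + _).
by rewrite opprB [E + _]addrC -addrA subrKC addrC.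
Qed.

End Step.

(** * Growth of orders, and uniqueness of the coefficient of a dendriform equation *)

Lemma ord_ge_prelie p q x y : ord_ge p x -> ord_ge q y -> ord_ge (p + q) (prelie x y).
Proof.
move=> xp yq n lt_n; rewrite prelieE series_coefD oppr_coef.
have -> : (x ≻ y) n = 0 by exact: (ord_ge_cauchy (@aug_succ k A) xp yq).
have -> : (y ≺ x) n = 0 by apply: (ord_ge_cauchy (@aug_prec k A) yq xp); rewrite addnC.
by rewrite subr0.
Qed.

(** The first summand with nonzero coefficient is u ▷ u, of order at least 2m + 2, and further
    iterates only raise the order. *)
Lemma ord_ge_fer m u : ord_ge m.+1 u -> ord_ge m.+2 (fer u).
Proof.
move=> um.
have iter_ge l : ord_ge m.+2 (iter l.+1 (prelie u) u).
  elim: l => [|l IHl] n lt_nm; rewrite iterS.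
    by apply: (ord_ge_prelie um um); rewrite (leq_trans lt_nm) // addnS addSn !ltnS leq_addl.
  by apply: (ord_ge_prelie um IHl); rewrite (leq_trans lt_nm) // leq_addl.
move=> n lt_nm; rewrite /fer /adic_sum big1 // => -[[|l] lt_ln] _.
  by rewrite mulr0 mul0r scale0r.
by rewrite series_coefZ iter_ge ?scaler0.
Qed.

Lemma coef0_dend_eq u x : u 0%N = 0 -> x = 1 + (u ≺ x) -> x 0%N = 1.
Proof.
move=> u0 xE; rewrite xE series_coefD series_coef1 /sprec /cauchy big_ord1 u0.
by rewrite linear0l addr0.
Qed.

Lemma snd_dend_eq u x n : x = 1 + (u ≺ x) -> (x n).2 = (n == 0%N)%:R.
Proof. by move->; rewrite series_coefD /= coef1_snd unitfree_sprec addr0. Qed.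

(** The difference w satisfies w ≺ x = 0 with x of constant term 1. Once lower coefficients vanish,
    the next one reads w_n ≺ 1 = 0, and w_n ≺ 1 = w_n because w is unit-free. *)
Lemma dend_eq_inj u v x : unitfree u -> unitfree v -> u 0%N = 0 ->
  x = 1 + (u ≺ x) -> x = 1 + (v ≺ x) -> u = v.
Proof.
move=> u_free v_free u0 xu xv; apply/subr0_eq; set w := u - v.
have w_free : unitfree w by apply/unitfreeD/unitfreeN.
have wx : w ≺ x = 0.
  rewrite sprecDl sprecNl; apply: subr0_eq; rewrite subr0; apply/eqP.
  by rewrite subr_eq0 -(inj_eq (@addrI _ 1)) -xu -xv.
have x0 := coef0_dend_eq u0 xu.
apply/funext => n; elim/ltn_ind: n => n IHn.
have := congr1 (fun y => y n) wx; rewrite /sprec /cauchy big_ord_recr /= subnn x0.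
rewrite big1 ?add0r; last by move=> i _; rewrite IHn // linear0l.
by rewrite (unitfreeP w_free) aug_prec1.
Qed.

(** Scalar parts multiply, so exp(u) has scalar part 1. By strong induction on the degree, only the
    linear term of exp(u) can contribute a scalar of [u]. *)
Lemma unitfree_of_sexp u x y : u 0%N = 0 ->
  (forall n, (x n).2 = (n == 0%N)%:R) -> (forall n, (y n).2 = (n == 0%N)%:R) ->
  x = sexp u * y -> unitfree u.
Proof.
move=> u0 x1 y1 xE.
have E1 n : (sexp u n).2 = (n == 0%N)%:R.
  rewrite -x1 xE snd_coefM big_ord_recr /= subnn y1 mulr1 big1 ?add0r // => i _.
  by rewrite y1 subn_eq0 leqNgt ltn_ord mulr0.
elim/ltn_ind => -[|n] IHn; first by rewrite u0.
have := E1 n.+1; rewrite sexpE /adic_sum snd_sum !big_ord_recl /= scaler0 add0r.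
rewrite {1 2}/bump /= invr1 scale1r expr1 big1 ?addr0 // => i _.
(* In a power of exponent at least 2, the top coefficient of [u] meets the constant term 0 of the
   other factor. *)
rewrite /bump /= !add1n exprS snd_coefM big_ord_recr /= subnn coef_sexpr_small // mulr0 addr0.
by rewrite big1 ?scaler0 // => j _; rewrite IHn ?mul0r.
Qed.

End Fer.

(** Expanding x in y * x, the term y ≻ (u ≺ x) = (y ≻ u) ≺ x yields -(y ≺ x), while y ≺ (u ≺ x)
    yields y ≺ x - y + 1. *)
Lemma dend_eq_inverse (k : fieldType) (A : dendriformType k) (u x y : series (augm A)) :
  unitfree u -> x = 1 + (u ≺ x) -> y = 1 - (y ≻ u) -> y * x = 1.
Proof.
move=> u_free xE yE.
rewrite {1}xE mulrDr mulr1 mul_dend; last by right; apply: unitfree_sprec.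
have -> : y ≻ (u ≺ x) = (1 - y) ≺ x by rewrite {2}yE opprB subrKC ssuccprecA.
have -> : y ≺ (u ≺ x) = (y ≺ x) - (y ≺ 1).
  by rewrite {2}xE sprecDr [_ + (y ≺ (u ≺ x))]addrC addrK.
have -> : y ≺ 1 = y - 1.
  have {1}-> : y = (y - 1) + 1 by rewrite subrK.
  rewrite sprecDl sprec1l addr0 sprec1r // {1}yE addrAC subrr add0r.
  exact/unitfreeN/unitfree_ssucc.
rewrite sprecDl sprec1l sprecNl add0r addrAC subrr add0r.
by rewrite opprB subrKC.
Qed.

Lemma ord_ge_mull (k : fieldType) (A : dendriformType k) m (x y : series (augm A)) :
  ord_ge m x -> ord_ge m (y * x).
Proof. by move=> xm; apply: (@ord_ge_cauchy _ _ (@aug_mul k A) 0). Qed.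

Lemma ord_ge_mulr (k : fieldType) (A : dendriformType k) m (x y : series (augm A)) :
  ord_ge m x -> ord_ge m (x * y).
Proof.
by move=> xm n lt_nm; apply: (@ord_ge_cauchy _ _ (@aug_mul k A) m 0); rewrite ?addn0.
Qed.

(** * Ordered products and their inverses in reversed order *)

Section RevProd.
Variables (R : nzRingType) (F G : nat -> R).

Lemma prod_rev_recl n :
  \prod_(i < n.+1) G (rev_ord i) = G n * \prod_(i < n) G (rev_ord i).
Proof. by rewrite big_ord_recl /= subn1. Qed.

Lemma prod_rev_mulV n : (forall i, G i * F i = 1) ->
  (\prod_(i < n) G (rev_ord i)) * (\prod_(i < n) F i) = 1.
Proof.
move=> GF; elim: n => [|n IHn]; first by rewrite !big_ord0 mulr1.
by rewrite prod_rev_recl big_ord_recr /= mulrA -(mulrA (G n)) IHn mulr1.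
Qed.

Lemma prod_mulV_rev n : (forall i, F i * G i = 1) ->
  (\prod_(i < n) F i) * (\prod_(i < n) G (rev_ord i)) = 1.
Proof.
move=> FG; elim: n => [|n IHn]; first by rewrite !big_ord0 mulr1.
by rewrite prod_rev_recl big_ord_recr /= mulrA -(mulrA _ (F n)) FG mulr1.
Qed.

End RevProd.

(** The limits X and Y alone do not fix [U]: a change of [U 1] can be compensated by later factors.
    The third clause therefore ties each [U n] to the remainder R left after n factors. *)
Theorem theorem6 (k : fieldType) (char_k : [pchar k] =i pred0)
    (A : dendriformType k) (a : A)
    (X Y : series (augm A)) (U : nat -> series (augm A))
    (solX : X = 1 + lam a ≺ X) (solY : Y = 1 - Y ≻ lam a)
    (U0 : U 0%N = lam a) (U_lam : forall n, U n 0%N = 0) :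
  [/\ adic_cvg (fun n => \prod_(i < n) sexp (U i)) X,
      adic_cvg (fun n => \prod_(i < n) sexp (- U (rev_ord i))) Y
    & forall n (R : series (augm A)),
        X = (\prod_(i < n) sexp (U i)) * R -> R = 1 + U n ≺ R]
  <-> (forall n, U n.+1 = fer (U n)).
Proof.
pose P n := \prod_(i < n) sexp (U i).
pose Q n := \prod_(i < n) sexp (- U (@rev_ord n i)).
have PE n : \prod_(i < n) sexp (U i) = P n := erefl.
have QE n : \prod_(i < n) sexp (- U (rev_ord i)) = Q n := erefl.
have Q0 : Q 0%N = 1 by rewrite /Q big_ord0.
have QP n : Q n * P n = 1.
  exact: (prod_rev_mulV n (fun i => sexpNK char_k (U_lam i))).
have PQ n : P n * Q n = 1.
  exact: (prod_mulV_rev n (fun i => sexpKN char_k (U_lam i))).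
have QXS n : Q n.+1 * X = sexp (- U n) * (Q n * X).
  by rewrite /Q (prod_rev_recl (fun i => sexp (- U i))) mulrA.
(* From here on the remainder after n factors is [Q n * X], and only the inverse relations and the
   recursion [QXS] are used. *)
clearbody P Q.
split=> [[_ _ remE] n|U_fer].
- have QXE m : Q m * X = 1 + U m ≺ Q m * X.
    by apply: remE; rewrite PE mulrA PQ mul1r.
  have U_free m : unitfree (U m).
    apply: (@unitfree_of_sexp _ _ _ (Q m * X) (Q m.+1 * X)) => // [i|i|].
    + exact/snd_dend_eq/QXE.
    + exact/snd_dend_eq/QXE.
    + by rewrite QXS mulrA (sexpKN char_k (U_lam m)) mul1r.
  (* Both [U n.+1] and [fer (U n)] are coefficients of an equation solved by the same remainder. *)
  apply: (@dend_eq_inj _ _ _ _ (Q n.+1 * X)) => //; first exact: unitfree_fer.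
  by rewrite QXS; exact/sexp_step/QXE.
have U_free n : unitfree (U n).
  by case: n => [|n]; [rewrite U0; apply: unitfree_lam | rewrite U_fer; apply: unitfree_fer].
have U_ge n : ord_ge n.+1 (U n).
  elim: n => [|n IHn]; last by rewrite U_fer; apply: ord_ge_fer.
  by case=> // _; apply: U_lam.
have QXE n : Q n * X = 1 + U n ≺ Q n * X.
  elim: n => [|n IHn]; last by rewrite QXS U_fer; exact: sexp_step.
  by rewrite Q0 mul1r U0.
have QX_ge n : ord_ge n.+1 (1 - Q n * X).
  move=> i lt_in; rewrite QXE opprD addrA subrr add0r oppr_coef.
  rewrite [(_ ≺ _) i](ord_ge_cauchy (@aug_prec k A) (U_ge n) (q := 0%N)) ?oppr0 //.
  by rewrite addn0.
have YX : Y * X = 1 by apply: dend_eq_inverse solX solY; apply: unitfree_lam.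
split=> [n|n|n R XE].
- exists n => m le_nm; apply: subr0_eq; rewrite -oppr_coef -series_coefD PE.
  have -> : P m - X = P m * (1 - Q m * X) by rewrite mulrBr mulr1 mulrA PQ mul1r.
  by apply: (ord_ge_mull _ (QX_ge m)); rewrite ltnS.
- exists n => m le_nm; apply: subr0_eq; rewrite -oppr_coef -series_coefD QE.
  (* By [YX] and [PQ], [Q m] is Y * X * [Q m] and Y is Y * [P m] * [Q m], which leaves 1 minus the
     remainder as a factor. *)
  have -> : Q m - Y = - (Y * P m) * (1 - Q m * X) * Q m.
    have YPQ : Y * P m * Q m = Y by rewrite -mulrA PQ mulr1.
    by rewrite mulrBr mulr1 mulrBl !mulNr opprK mulrA YPQ YX mul1r addrC.
  by apply: (ord_ge_mulr _ (ord_ge_mull _ (QX_ge m))); rewrite ltnS.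
- have -> : R = Q n * X by rewrite XE PE mulrA QP mul1r.
  exact: QXE.
Qed.
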